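(* Let $R$ be an exchange ring. Then $R$ is a right $\Sigma$-$V$ ring if and only if $R$ is a left $\Sigma$-$V$ ring.
   Context: All rings are associative with identity element and modules are unital. A (right or left) $R$-module $M$ is called $\Sigma$-injective if the direct sum $M^{(\alpha)}$ of $\alpha$ copies of $M$ is injective for every cardinal $\alpha$. A ring $R$ is called a right (resp. left) $\Sigma$-$V$ ring if each simple right (resp. left) $R$-module is $\Sigma$-injective. A ring $R$ is an exchange ring if the module $R_R$ (equivalently ${}_RR$) satisfies the (finite) exchange property; equivalently, for each $a\in R$ there exists an idempotent $e\in R$ such that $e\in aR$ and $1-e\in(1-a)R$. *)

(* Defs.v *)
From HB Require Import structures.
From mathcomp Require Import all_boot all_order all_algebra.
From mathcomp Require Import boolp classical_sets functions cardinality.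

Set Implicit Arguments.
Unset Strict Implicit.
Unset Printing Implicit Defensive.

Import GRing.Theory.
Local Open Scope classical_set_scope.
Local Open Scope ring_scope.

(* A left R-module is an [lmodType R], and a right R-module is an
   [lmodType R^c] over the converse (opposite) ring [R^c].  Rings are
   [pzRingType]s, so the zero ring is allowed. *)

Definition submodule (R : pzRingType) (M : lmodType R) (S : set M) : Prop :=
  GRing.submod_closed [in S].

Definition simple_module (R : pzRingType) (M : lmodType R) : Prop :=
  (exists x : M, x != 0) /\
  forall S : set M, submodule S -> S = [set 0] \/ S = setT.

Definition injective_module (R : pzRingType) (M : lmodType R) : Prop :=
  forall (A B : lmodType R) (f : {linear A -> B}) (g : {linear A -> M}),
    injective f -> exists h : {linear B -> M}, h \o f =1 g.

Section DirectPower.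
Variables (I : Type) (R : pzRingType) (M : lmodType R).

Definition finite_support : {pred I -> M} :=
  fun f => `[< finite_set [set i | f i != 0] >].

Lemma finite_supportP (f : I -> M) :
  reflect (finite_set [set i | f i != 0]) (f \in finite_support).
Proof. exact: asboolP. Qed.

Fact finite_support_submod_closed : GRing.submod_closed finite_support.
Proof.
split=> [|a f g /finite_supportP finf /finite_supportP fing];
  apply/finite_supportP.
  by rewrite [X in finite_set X](_ : _ = set0)// -subset0 => i /=; rewrite eqxx.
apply: (@sub_finite_set _ _ ([set i | f i != 0] `|` [set i | g i != 0]));
  last by rewrite finite_setU.
move=> i /=; case: (eqVneq (f i) 0) => [fi0|]; last by left.
case: (eqVneq (g i) 0) => [gi0|]; last by right.
by rewrite [_ i](_ : _ = a *: f i + g i)// fi0 gi0 scaler0 addr0 eqxx.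
Qed.

HB.instance Definition _ := GRing.isSubmodClosed.Build R (I -> M)
  finite_support finite_support_submod_closed.

(* The direct sum of copies of M indexed by I, as the submodule of finitely
   supported functions inside the product module [I -> M]. *)
Record direct_power : Type := DirectPower {
  direct_power_val :> I -> M;
  _ : direct_power_val \in finite_support }.

HB.instance Definition _ := [isSub for direct_power_val].
HB.instance Definition _ := [Choice of direct_power by <:].
HB.instance Definition _ := [SubChoice_isSubLmodule of direct_power by <:].

End DirectPower.

(* Cardinals are represented by arbitrary index types. *)
Definition Sigma_injective (R : pzRingType) (M : lmodType R) : Prop :=
  forall I : Type, injective_module (direct_power I M).

Definition left_Sigma_V_ring (R : pzRingType) : Prop :=
  forall M : lmodType R, simple_module M -> Sigma_injective M.

Definition right_Sigma_V_ring (R : pzRingType) : Prop :=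
  forall M : lmodType R^c, simple_module M -> Sigma_injective M.

Definition internal_direct_sum (R : pzRingType) (A : lmodType R)
    (J : finType) (B : J -> set A) : Prop :=
  (forall j, submodule (B j)) /\
  forall x : A, exists! u : {ffun J -> A},
    (forall j, B j (u j)) /\ x = \sum_j u j.

(* Whenever A = M' (+) N = (+)_(i < n) B_i with M' isomorphic to M (so that M'
   is the range of an injective linear map M -> A), there are submodules
   C_i of B_i such that A = M' (+) (+)_(i < n) C_i. In the last decomposition
   the index [None] stands for the summand M'. *)
Definition finite_exchange_property (R : pzRingType) (M : lmodType R) : Prop :=
  forall (A : lmodType R) (f : {linear M -> A}) (N : set A)
         (n : nat) (B : 'I_n -> set A),
    injective f ->
    internal_direct_sum (fun b : bool => if b then range f else N) ->
    internal_direct_sum B ->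
    exists C : 'I_n -> set A,
      (forall i, C i `<=` B i) /\
      internal_direct_sum (fun o : option 'I_n => oapp C (range f) o).

(* [R^c^o] is the right regular module: a *: x is x * a in R. *)
Definition exchange_ring (R : pzRingType) : Prop :=
  finite_exchange_property (R^c^o : lmodType R^c).

(* Main.v *)
Require Import Defs.
From HB Require Import structures.
From mathcomp Require Import all_boot all_order all_algebra.
From mathcomp Require Import ring_quotient generic_quotient.
From mathcomp Require Import boolp classical_sets functions cardinality.

(** Over an exchange ring the left Sigma-V condition is equivalent to a condition
    that does not distinguish left from right: R is von Neumann regular, and no
    prime factor ring of R has an infinite sequence of nonzero orthogonal
    idempotents (equivalently, all prime factors are artinian).  This is
    [left_Sigma_V_characterization]; the theorem follows by applying it to R and
    to the converse ring.  The exchange hypothesis is used on both sides, in the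
    form: every a has an idempotent e in Ra with 1 - e in R(1 - a).  The right and
    the left versions are extracted together from one exchange decomposition of
    R x R ([exchange_comaximal], [comaximal_left_idempotent]).

    Let R be an exchange left Sigma-V ring.
    - If x lies outside a left ideal Q, the injectivity of a suitable simple
      module gives t such that 1 - tx is killed by a map h on R that kills Q but
      not 1; exchange applied to tx then yields an idempotent of Rx outside Q
      ([Sigma_V_idempotents_avoid]).
    - If S is simple and e_n are orthogonal idempotents with e_n S <> 0, vectors
      s_n in e_n S define a map from the sum of the R e_n to the direct sum of
      copies of S; the image of 1 under an extension to R would have infinite
      support ([Sigma_injective_orthogonal]).
    - For a prime ideal Q and orthogonal e_n outside Q, primeness and the first
      point give decreasing idempotents g_n in R e_n R outside Q.  A maximal left
      ideal containing all 1 - g_n gives a simple module that no e_n kills, which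
      contradicts the second point
      ([Sigma_V_prime_no_orthogonal_sequence]).
    - Hence each left ideal is generated by an idempotent modulo Q, so R is
      regular modulo every prime.  All ideals are semiprime by the first point,
      and an ideal maximal among those modulo which a fixed element is not
      regular would be prime; so R is regular ([Sigma_V_regular]).

    Conversely, let R be regular without such sequences, T simple and P its
    annihilator, a prime ideal.  A linear map from a left ideal L to a direct sum
    of copies of T kills P intersected with L, because every z in this
    intersection is zuz with zu in P; and L is generated modulo P by some g in
    L.  So the map is l |-> l m where m is the image of g, and Baer's criterion
    applies ([regular_Sigma_V]). *)

Set Implicit Arguments.
Unset Strict Implicit.
Unset Printing Implicit Defensive.

Import GRing.Theory.
Local Open Scope classical_set_scope.
Local Open Scope ring_scope.

(** * Submodules, quotient modules and Zorn's lemma *)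

Lemma submoduleP (R : pzRingType) (M : lmodType R) (S : set M) :
  submodule S <-> S 0 /\ forall a x y, S x -> S y -> S (a *: x + y).
Proof.
split=> [[S0 SD]|[S0 SD]]; split; rewrite ?inE//.
- by move: S0; rewrite inE.
- by move=> a x y Sx Sy; apply/set_mem/SD; apply/mem_set.
- by move=> a x y /set_mem Sx /set_mem Sy; apply/mem_set/SD.
Qed.

Section SubmoduleType.
Variables (R : pzRingType) (M : lmodType R) (S : set M) (hS : submodule S).

(** The proof argument makes this constant a key on which the closure properties
    of the submodule can be inferred. *)
Definition submodule_mem of submodule S : {pred M} := [in S].

Fact submodule_mem_closed : GRing.submod_closed (submodule_mem hS).
Proof. exact: hS. Qed.

HB.instance Definition _ :=
  GRing.isSubmodClosed.Build R M (submodule_mem hS) submodule_mem_closed.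

Record submodule_type : Type := SubmoduleType {
  submodule_val :> M; _ : submodule_val \in submodule_mem hS }.

HB.instance Definition _ := [isSub for submodule_val].
HB.instance Definition _ := [Choice of submodule_type by <:].
HB.instance Definition _ := [SubChoice_isSubLmodule of submodule_type by <:].

Definition quotient_module : Type := Quotient.quot (submodule_mem hS).
HB.instance Definition _ := GRing.Zmodule.on quotient_module.

Local Notation pi := (\pi_(Quotient.quot (submodule_mem hS))%qT).
Definition to_quotient (x : M) : quotient_module := pi x.

Lemma to_quotient_eq x y : (to_quotient x = to_quotient y) <-> S (x - y).
Proof.
split=> [/eqP|h]; last apply/eqP; rewrite -Quotient.idealrBE.
  by move=> /set_mem.
exact: mem_set.
Qed.

Lemma to_quotient_surj q : exists x, q = to_quotient x.
Proof. by elim/quotP: q => x _; exists x. Qed.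

Definition quotient_scale (a : R) (q : quotient_module) : quotient_module :=
  to_quotient (a *: (repr (q : Quotient.quot (submodule_mem hS)))).

Lemma to_quotientD x y : to_quotient (x + y) = to_quotient x + to_quotient y.
Proof. by rewrite /to_quotient raddfD. Qed.

Lemma quotient_scaleE a x :
  quotient_scale a (to_quotient x) = to_quotient (a *: x).
Proof.
apply/to_quotient_eq; rewrite -scalerBr.
have /to_quotient_eq h : to_quotient (repr (pi x)) = to_quotient x.
  by rewrite /to_quotient reprK.
by have := rpredZ a (mem_set h : _ \in submodule_mem hS); move=> /set_mem.
Qed.

Fact quotient_scaleA a b q :
  quotient_scale a (quotient_scale b q) = quotient_scale (a * b) q.
Proof.
by have [x ->] := to_quotient_surj q; rewrite !quotient_scaleE scalerA.
Qed.

Fact quotient_scale1 : left_id 1 quotient_scale.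
Proof.
by move=> q; have [x ->] := to_quotient_surj q; rewrite quotient_scaleE scale1r.
Qed.

Fact quotient_scaleDr : right_distributive quotient_scale +%R.
Proof.
move=> a q r; have [x ->] := to_quotient_surj q.
have [y ->] := to_quotient_surj r.
by rewrite -to_quotientD !quotient_scaleE scalerDr to_quotientD.
Qed.

Fact quotient_scaleDl q : {morph quotient_scale^~ q : a b / a + b}.
Proof.
move=> a b; have [x ->] := to_quotient_surj q.
by rewrite !quotient_scaleE scalerDl to_quotientD.
Qed.

HB.instance Definition _ := GRing.Zmodule_isLmodule.Build R quotient_module
  quotient_scaleA quotient_scale1 quotient_scaleDr quotient_scaleDl.

Fact to_quotient_linear : linear to_quotient.
Proof. by move=> a x y; rewrite to_quotientD -quotient_scaleE. Qed.

HB.instance Definition _ :=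
  GRing.isLinear.Build R M quotient_module *:%R to_quotient to_quotient_linear.

End SubmoduleType.

Lemma submodule_bigcup (R : pzRingType) (M : lmodType R) (F : set (set M))
    (S0 : set M) : F S0 ->
  (forall S, F S -> submodule S) -> total_on F subset ->
  submodule (\bigcup_(S in F) S).
Proof.
move=> FS0 FP Ftot; apply/submoduleP; split.
  by exists S0 => //; have /submoduleP[] := FP _ FS0.
move=> a x y [X FX Xx] [Y FY Yy].
have closed Z : F Z -> Z x -> Z y -> (\bigcup_(S in F) S) (a *: x + y).
  by move=> FZ Zx Zy; exists Z => //; have /submoduleP[_ ZD] := FP Z FZ; exact: ZD.
case: (Ftot X Y FX FY) => [XY|YX]; first by apply: (closed Y) => //; exact: XY.
by apply: (closed X) => //; exact: YX.
Qed.

(** [Zorn_bigcup] also asks for the union of the empty chain, which is rarely an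
    object of the kind considered; starting the chains at [A0] removes this. *)
Lemma Zorn_above (T : Type) (P : set (set T)) (A0 : set T) : P A0 ->
  (forall F : set (set T), F A0 -> F `<=` P -> total_on F subset ->
    P (\bigcup_(X in F) X)) ->
  exists A, [/\ A0 `<=` A, P A & forall B, A `<=` B -> P B -> B = A].
Proof.
move=> PA0 chainP.
have [F FP Ftot|A [PA maxA]] := @Zorn_bigcup T [set X | P (A0 `|` X)].
  pose F' := [set A0] `|` [set A0 `|` X | X in F].
  rewrite /=; suff -> : A0 `|` \bigcup_(X in F) X = \bigcup_(X in F') X.
    apply: chainP; first by left.
      by move=> _ [->//|[X FX <-]]; exact: FP.
    move=> _ _ [->|[X FX <-]] [->|[Y FY <-]]; [by left|by left|by right|].
    by case: (Ftot X Y FX FY) => XY; [left|right]; exact: setUS.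
  apply/seteqP; split=> t.
    case=> [A0t|[X FX Xt]]; first by exists A0 => //; left.
    by exists (A0 `|` X); [right; exists X|right].
  case=> _ [->|[X FX <-]]; first by left.
  by case=> [|Xt]; [left|right; exists X].
exists (A0 `|` A); split=> // B AB PB; apply: contrapT => neB.
apply: (maxA B); last by rewrite /= setUidr// => t A0t; apply: AB; left.
split=> [t At|BA]; first by apply: AB; right.
by apply: neB; apply/seteqP; split=> // t /BA; right.
Qed.

(** * Injectivity in terms of graphs *)

Definition single_valued (R : pzRingType) (B M : lmodType R)
    (G : set (B * M)) : Prop :=
  forall m, G (0, m) -> m = 0.

(** The graph [G] is itself a module, and it embeds in [B] because it is
    single-valued; the extension of its second projection is the map wanted. *)
Lemma injective_extends (R : pzRingType) (B M : lmodType R) (G : set (B * M)) :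
  injective_module M -> submodule G -> single_valued G ->
  exists h : {linear B -> M}, forall x y, G (x, y) -> h x = y.
Proof.
move=> injM hG svG.
pose toB : {linear submodule_type hG -> B} := fst \o val.
pose toM : {linear submodule_type hG -> M} := snd \o val.
have toB_inj : injective toB.
  apply: raddf_inj => -[[b m] Gbm] /= b0; apply: val_inj => /=.
  have Gm := set_mem Gbm; rewrite b0 in Gm *.
  by rewrite (svG m Gm).
have [h hE] := injM _ _ toB toM toB_inj.
exists h => x y Gxy.
exact: (hE (SubmoduleType (mem_set Gxy : _ \in submodule_mem hG))).
Qed.

(** A maximal single-valued submodule [G] of [B * M] above the given map is
    total: for [b] in [B], the pairs [(r, y)] with [(r b, y)] in [G] form a
    partial map from [R], which is multiplication by some [m], and [b |-> m] can
    be added to [G]. *)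
Lemma Baer_criterion (R : pzRingType) (M : lmodType R) :
  (forall G : set (R^o * M), submodule G -> single_valued G ->
     exists m : M, forall x y, G (x, y) -> y = (x : R) *: m) ->
  injective_module M.
Proof.
move=> baer A B f g f_inj.
pose P (G : set (B * M)) := submodule G /\ single_valued G.
pose G0 : set (B * M) := [set z | exists a, z = (f a, g a)].
have PG0 : P G0.
  split.
    apply/submoduleP; split; first by exists 0; rewrite !linear0.
    by move=> c _ _ [a ->] [b ->]; exists (c *: a + b); rewrite !linearP.
  move=> m [a [/esym fa0 ->]].
  by rewrite -(linear0 f) in fa0; rewrite (f_inj _ _ fa0) linear0.
have [F FG0 FP Ftot|G [G0G [/submoduleP[G00 GD] svG] maxG]] := Zorn_above PG0.
  split; last by move=> m [X FX]; exact: (FP X FX).2.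
  by apply: (submodule_bigcup FG0) => // X /FP[].
have total b : exists m, G (b, m).
  have [||m mE] := baer [set ry | G (ry.1 *: b, ry.2)].
  - apply/submoduleP; split=> /=; first by rewrite scale0r.
    move=> a [r x] [s y] /= Gr Gs.
    by rewrite scalerDl -scalerA; exact: (GD a (_, _) (_, _)).
  - by move=> m /=; rewrite scale0r; exact: svG.
  exists m.
  (* [H] is the sum of [G] and the submodule generated by [(b, m)]. *)
  pose H : set (B * M) := [set z | exists r, G (z.1 - r *: b, z.2 - r *: m)].
  suff <- : H = G by exists 1; rewrite /= !scale1r !subrr.
  apply: maxG.
    by move=> z Gz; exists 0; rewrite !scale0r !subr0; case: z Gz.
  split.
    apply/submoduleP; split; first by exists 0; rewrite !scale0r !subr0.
    move=> a [x x'] [y y'] [r /= Gx] [s /= Gy]; exists (a * r + s) => /=.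
    have := GD a _ _ Gx Gy; congr (G (_, _)) => /=;
      by rewrite scalerBr addrACA -opprD scalerA scalerDl.
  move=> n [r /=]; rewrite sub0r => Gn.
  apply: (addIr (- (r *: m))); rewrite add0r -scaleNr.
  by apply: mE; rewrite /= !scaleNr.
have [h hE] := choice total.
have G_eq b m : G (b, m) -> m = h b.
  move=> Gbm; apply/subr0_eq/svG.
  have : G (-1 *: b + b, -1 *: h b + m).
    exact: (GD _ (_, _) (_, _) (hE b) Gbm).
  by rewrite !scaleN1r addNr addrC.
have h_linear : linear h.
  by move=> a x y; apply/esym/G_eq; exact: (GD a (_, _) (_, _) (hE x) (hE y)).
pose hL := GRing.isLinear.Build R B M *:%R h h_linear.
pose h' : {linear B -> M} := HB.pack h hL.
by exists h' => a /=; apply/esym/G_eq/G0G; exists a.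
Qed.

(** A module is its own direct power over a one-point index type. *)
Lemma Sigma_injective_extends (R : pzRingType) (B M : lmodType R)
    (G : set (B * M)) :
  Sigma_injective M -> submodule G -> single_valued G ->
  exists h : {linear B -> M}, forall x y, G (x, y) -> h x = y.
Proof.
move=> injM /submoduleP[G0 GD] svG.
pose H := [set z : B * direct_power unit M | G (z.1, z.2 tt)].
have [||h hE] := @injective_extends R B _ H (injM unit).
- apply/submoduleP; split; first exact: G0.
  by move=> a x y Hx Hy; exact: (GD a _ _ Hx Hy).
- move=> m Hm; apply/val_inj/funext => -[].
  exact: svG Hm.
pose ev (v : direct_power unit M) := v tt.
have ev_linear : linear ev by [].
pose evL := GRing.isLinear.Build R (direct_power unit M) M *:%R ev ev_linear.
pose ev' : {linear direct_power unit M -> M} := HB.pack ev evL.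
exists (ev' \o h) => x y Gxy /=.
have fin : (fun _ : unit => y) \in finite_support (M := M).
  exact/finite_supportP/finite_finset.
by rewrite (hE x (DirectPower fin)).
Qed.

(** * Exchange rings *)

Definition exchange_elementwise (R : pzRingType) : Prop :=
  forall a : R, exists e : R,
    [/\ e * e = e, exists r, e = r * a & exists s, 1 - e = s * (1 - a)].

Lemma comaximal_right_idempotent (R : pzRingType) (a b x y : R) :
  a * x + b * y = 1 -> y * (a * x) = 0 -> x * (b * y) = 0 ->
  exists e, [/\ e * e = e, exists r, e = a * r & exists s, 1 - e = b * s].
Proof.
move=> axby yax xby; exists (a * x).
have xax : x * (a * x) = x.
  by rewrite -[RHS]mulr1 -axby mulrDr xby addr0.
split; first by rewrite -mulrA xax.
  by exists x.
by exists y; rewrite -axby addrAC subrr add0r.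
Qed.

(** The relations on [x] and [y] are those of a normalized right-handed solution
    of the exchange equation. As [a] and [b] commute, solving a x + b y = 1 for
    c = x - y gives x = 1 + b c and y = 1 - a c. Writing [c] on the other side,
    p = 1 + c b and q = 1 - c a satisfy p a + q b = 1; the idempotent is p a,
    and its idempotency reduces to p y = 0. *)
Lemma comaximal_left_idempotent (R : pzRingType) (a b x y : R) : a + b = 1 ->
  a * x + b * y = 1 -> y * (a * x) = 0 -> x * (b * y) = 0 ->
  exists e, [/\ e * e = e, exists r, e = r * a & exists s, 1 - e = s * b].
Proof.
move=> ab1 axby yax xby.
have [c cE] : exists c, c = x - y by exists (x - y).
pose p : R := 1 + c * b; pose q : R := 1 - c * a.
have bE : b = 1 - a by rewrite -ab1 addrAC subrr add0r.
have bc : 1 + b * c = x.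
  rewrite -axby cE mulrBr addrACA.
  by rewrite subrr addr0 -mulrDl ab1 mul1r.
have ac : 1 - a * c = y.
  rewrite -axby cE mulrBr opprB [a * x + _]addrC addrACA.
  by rewrite subrr addr0 -mulrDl [b + a]addrC ab1 mul1r.
have pqc : p = q + c by rewrite /p /q bE mulrBr mulr1 addrAC addrA.
have yby : y * (b * y) = y.
  by rewrite -[RHS]mulr1 -axby mulrDr yax add0r.
have paqb : p * a + q * b = 1.
  rewrite /p /q !mulrDl !mul1r addrACA ab1 mulNr -!mulrA.
  by rewrite bE mulrBr mulrBl mulr1 mul1r subrr addr0.
have aq : a * q = y * a.
  by rewrite -ac /q mulrBr mulrBl mulr1 mul1r mulrA.
have bp : b * p = x * b by rewrite -bc /p mulrDr mulrDl mulr1 mul1r mulrA.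
have py0 : p * y = 0.
  rewrite -[LHS]mul1r -ab1 mulrDl.
  have -> : b * (p * y) = 0 by rewrite mulrA bp -mulrA.
  rewrite addr0 pqc mulrA mulrDr aq.
  have -> : a * c = 1 - y by rewrite -ac opprB addrC subrK.
  rewrite mulrDl mulrBl mul1r -[X in _ + (X - _)]yby bE.
  by rewrite mulrBl mul1r mulrBr addrAC subrr sub0r mulrA subrr.
have fgE : 1 - p * a = q * b by rewrite -paqb addrAC subrr add0r.
exists (p * a); split; [|by exists p|by exists q].
apply/esym/subr0_eq; rewrite -[X in X - _]mulr1 -mulrBr fgE.
by rewrite -mulrA [a * _]mulrA aq !mulrA py0 !mul0r.
Qed.

Lemma internal_direct_sum_inj (R : pzRingType) (A : lmodType R) (J : finType)
    (B : J -> set A) (u v : {ffun J -> A}) :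
  internal_direct_sum B -> (forall j, B j (u j)) -> (forall j, B j (v j)) ->
  \sum_j u j = \sum_j v j -> u = v.
Proof.
move=> [_ dirB] Bu Bv uv; have [w [_ w_uniq]] := dirB (\sum_j u j).
by rewrite -(w_uniq u)// (w_uniq v).
Qed.

Lemma sum_option (V : nmodType) (J : finType) (F : option J -> V) :
  \sum_o F o = F None + \sum_j F (Some j).
Proof.
rewrite (bigD1 None)//=; congr (_ + _).
rewrite (reindex_omap Some id) => [|[]//].
by apply: eq_bigl => j; rewrite eqxx.
Qed.

(** The map t |-> (t a, t b) embeds [R] in R * R, with the antidiagonal as a
    complement. Exchange against the two coordinate submodules gives
    R * R = f R (+) C0 (+) C1 with each Ci in the i-th coordinate axis; [x] and [y] are the
    components in f R of the two basis vectors. Each of the three equations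
    expresses that some f t lies in C0 + C1, so that t = 0. *)
Lemma exchange_comaximal (R : pzRingType) (a b : R) :
  finite_exchange_property (R^o : lmodType R) -> a + b = 1 ->
  exists x y, [/\ a * x + b * y = 1, y * (a * x) = 0 & x * (b * y) = 0].
Proof.
move=> exR ab1.
pose A : lmodType R := (R^o * R^o)%type.
pose f (t : R^o) : A := (t * a, t * b).
have f_linear : linear f.
  by move=> c s t; rewrite /f !mulrDl -!mulrA.
pose fL := GRing.isLinear.Build R R^o A *:%R f f_linear.
pose f' : {linear R^o -> A} := HB.pack f fL.
have sum_f t : (f t).1 + (f t).2 = t :> R by rewrite /= -mulrDr ab1 mulr1.
pose N : set A := [set z : A | z.1 + z.2 = 0].
pose B (i : 'I_2) : set A :=
  [set z : A | if i == ord0 then z.2 = 0 else z.1 = 0].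
have range_f z : range f' z <-> z = f (z.1 + z.2).
  split=> [[t _ <-]|->]; last by exists (z.1 + z.2).
  by rewrite [X in _ = f X]sum_f.
have f_inj : injective f' by move=> s t st; rewrite -(sum_f s) -(sum_f t) [f s]st.
have sub_range : submodule (range f').
  apply/submoduleP; split; first by exists 0 => //; rewrite linear0.
  by move=> c _ _ [s _ <-] [t _ <-]; exists (c *: s + t) => //; rewrite linearP.
have dirN : internal_direct_sum (fun b : bool => if b then range f' else N).
  split=> [[]//|z].
    apply/submoduleP; split; first by rewrite /N /= addr0.
    move=> c u v; rewrite /N /= => u0 v0.
    by rewrite addrACA -scalerDr u0 v0 scaler0 addr0.
  have sumN : (z - f (z.1 + z.2)).1 + (z - f (z.1 + z.2)).2 = 0.
    rewrite /= addrACA -opprD -mulrDr ab1 mulr1; exact: subrr.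
  exists [ffun b : bool => if b then f (z.1 + z.2) else z - f (z.1 + z.2)].
  split.
    split=> [[]|]; rewrite ?big_bool ?ffunE//=.
      by exists (z.1 + z.2).
    by rewrite addrC subrK.
  move=> u [uP zE]; rewrite big_bool in zE.
  have /range_f uT := uP true.
  have uF : (u false).1 + (u false).2 = 0 := uP false.
  have uTE : u true = f (z.1 + z.2).
    by rewrite {1}uT zE /= addrACA uF addr0.
  apply/ffunP => -[]; rewrite ffunE ?uTE//=.
  by rewrite {1}zE -uTE addrAC subrr add0r.
have dirB : internal_direct_sum B.
  split=> [i|z].
    apply/submoduleP; rewrite /B /=; case: ifP => _; split=> // c u v /= -> ->;
    by rewrite scaler0 addr0.
  exists [ffun i : 'I_2 => if i == ord0 then (z.1, 0) else (0, z.2)]; split.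
    split=> [i|]; first by rewrite /B /= ffunE; case: ifP => ->.
    rewrite big_ord_recl big_ord1 !ffunE /=; case: (z) => z1 z2 /=.
    by congr pair; rewrite ?addr0 ?add0r.
  move=> u [uP ->]; rewrite big_ord_recl big_ord1.
  have := uP ord0; have := uP (lift ord0 ord0); rewrite /B /=.
  case u0E: (u ord0) => [u1 u2]; case u1E: (u (lift ord0 ord0)) => [v1 v2] /=.
  move=> v1_0 u2_0; rewrite v1_0 u2_0 in u0E u1E *.
  apply/ffunP => i; rewrite ffunE; case: (unliftP ord0 i) => [j|] ->.
    by rewrite (ord1 j) u1E /= add0r.
  by rewrite u0E /= addr0.
have [C [CB dirC]] := exR A f' N 2 B f_inj dirN dirB.
have [subC decC] := dirC.
pose i0 : 'I_2 := ord0; pose i1 : 'I_2 := lift ord0 ord0.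
have /submoduleP[C00 C0D] : submodule (C i0) := subC (Some i0).
have /submoduleP[C10 C1D] : submodule (C i1) := subC (Some i1).
have dec z : exists t u v, [/\ C i0 u, C i1 v & z = f t + u + v].
  have [w [[wC ->] _]] := decC z; have [t _ wE] := wC None.
  exists t, (w (Some i0)), (w (Some i1)); split.
  - exact: (wC (Some i0)).
  - exact: (wC (Some i1)).
  - by rewrite sum_option big_ord_recl big_ord1 addrA; congr (_ + _ + _).
have indep t u v : C i0 u -> C i1 v -> f t = u + v -> t = 0.
  move=> Cu Cv ftE.
  pose w : {ffun option 'I_2 -> A} := [ffun o => if o is None then f t else 0].
  pose w' : {ffun option 'I_2 -> A} :=
    [ffun o => if o is Some i then if i == i0 then u else v else 0].
  have ww' : w = w'.
    apply: (internal_direct_sum_inj dirC) => [[i|]|[i|]|].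
    - by rewrite ffunE; have /submoduleP[] := subC (Some i).
    - by rewrite ffunE; exists t.
    - rewrite ffunE; case: eqP => [->//|]; case: (unliftP ord0 i) => [j|] -> //.
      by rewrite (ord1 j).
    - by rewrite ffunE; have /submoduleP[] := subC None.
    rewrite !sum_option !big_ord_recl !big_ord0 !ffunE /=.
    by rewrite !addr0 add0r.
  have : w None = w' None by rewrite ww'.
  by rewrite !ffunE => ft0; apply: f_inj; rewrite [f' t]ft0 linear0.
pose e1 : A := (1, 0); pose e2 : A := (0, 1).
have [x [u1 [u2 [Cu1 Cu2 xE]]]] := dec e1.
have [y [v1 [v2 [Cv1 Cv2 yE]]]] := dec e2.
have fZ c t : f (c * t) = c *: f t by exact: (linearZZ f' c t).
have fD s t : f (s + t) = f s + f t by exact: (linearD f' s t).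
have fxE : f x = e1 - u1 - u2 by rewrite xE addrAC addrK addrK.
have fyE : f y = e2 - v1 - v2 by rewrite yE addrAC addrK addrK.
have C0N c u v : C i0 u -> C i0 v -> C i0 (- (c *: u) - v).
  by move=> Cu Cv; rewrite -opprD -scaleN1r -[_ *: _]addr0; exact/C0D/C00/C0D.
have C1N c u v : C i1 u -> C i1 v -> C i1 (- (c *: u) - v).
  by move=> Cu Cv; rewrite -opprD -scaleN1r -[_ *: _]addr0; exact/C1D/C10/C1D.
have u1_2 : u1.2 = 0 := CB i0 _ Cu1.
have u2_1 : u2.1 = 0 := CB i1 _ Cu2.
have v1_2 : v1.2 = 0 := CB i0 _ Cv1.
have v2_1 : v2.1 = 0 := CB i1 _ Cv2.
have v1E : v1 = - ((y * a) *: e1).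
  apply/eqP; rewrite -addr_eq0; apply/eqP; have := congr1 fst yE.
  rewrite /= v2_1 addr0 addrC => /esym h.
  by congr pair => /=; rewrite ?v1_2 ?scaler0 ?addr0// [_ *: _]mulr1.
have u2E : u2 = - ((x * b) *: e2).
  apply/eqP; rewrite -addr_eq0; apply/eqP; have := congr1 snd xE.
  rewrite /= u1_2 addr0 addrC => /esym h.
  by congr pair => /=; rewrite ?u2_1 ?scaler0 ?addr0// [_ *: _]mulr1.
exists x, y; split.
- apply/esym/subr0_eq.
  apply: (indep _ (a *: u1 + b *: v1) (a *: u2 + b *: v2)).
  + by apply: (C0D) => //; rewrite -[_ *: _]addr0; exact: C0D.
  + by apply: (C1D) => //; rewrite -[_ *: _]addr0; exact: C1D.
  have f1 : f 1 = a *: (f x + u1 + u2) + b *: (f y + v1 + v2).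
    rewrite -xE -yE; congr pair; rewrite /= !scaler0 ?addr0 ?add0r mul1r.
      by rewrite [_ *: _]mulr1.
    by rewrite [_ *: _]mulr1.
  rewrite fD -mulN1r fZ fD !fZ scaleN1r f1 !scalerDr addrACA.
  by rewrite [X in X + _ - _]addrACA -[X in X - _]addrA addrAC subrr add0r.
- apply: (indep _ (- ((y * a) *: u1) - v1) (- ((y * a) *: u2) - 0)).
  + exact: C0N.
  + exact: C1N.
  rewrite mulrA fZ fxE !scalerBr subr0 v1E opprK.
  by rewrite [X in X - _ = _]addrC.
- apply: (indep _ (- ((x * b) *: v1) - 0) (- ((x * b) *: v2) - u2)).
  + exact: C0N.
  + exact: C1N.
  rewrite mulrA fZ fyE !scalerBr subr0 u2E opprK.
  by rewrite [RHS]addrC [X in _ = X - _]addrC addrAC.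
Qed.

(** * Ideals and idempotents *)

Section Ideals.
Variable R : pzRingType.
Implicit Types (Q : set R) (e g : nat -> R).

Definition ideal Q : Prop :=
  submodule (Q : set R^o) /\ forall x r, Q x -> Q (x * r).

Lemma idealP Q : ideal Q <->
  [/\ Q 0, forall x y, Q x -> Q y -> Q (x - y),
      forall r x, Q x -> Q (r * x) & forall r x, Q x -> Q (x * r)].
Proof.
split=> [[/submoduleP[Q0 QD] QM]|[Q0 QB QMl QMr]].
  have QMl r x : Q x -> Q (r * x).
    by move=> Qx; rewrite -[_ * _]addr0; exact: (QD r x 0).
  split=> // [x y Qx Qy|r x Qx]; last exact: QM.
  by have := QD (-1) _ _ Qy Qx; rewrite [_ *: _]mulN1r addrC.
split; last by move=> x r; exact: QMr.
apply/submoduleP; split=> // a x y Qx Qy.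
by rewrite -[y]opprK -[- y]sub0r; apply/QB/QB => //; exact: QMl.
Qed.

Definition prime_ideal Q : Prop :=
  [/\ ideal Q, ~ Q 1 & forall x y, (forall r, Q (x * r * y)) -> Q x \/ Q y].

(** For a two-sided [Q]: every nonzero left ideal of R/Q contains a nonzero
    idempotent, which moreover lifts to an idempotent of the corresponding left
    ideal of [R]. *)
Definition idempotents_avoid Q : Prop :=
  forall x, ~ Q x -> exists y, let e := y * x in e * e = e /\ ~ Q e.

Definition orthogonal_idempotents e : Prop :=
  forall i j, e i * e j = if i == j then e i else 0.

(** The factor ring R/Q has no infinite sequence of nonzero orthogonal
    idempotents lifting to orthogonal idempotents of [R]. *)
Definition no_orthogonal_sequence Q : Prop :=
  forall e, orthogonal_idempotents e -> exists n, Q (e n).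

Definition von_neumann_regular : Prop :=
  forall a : R, exists x, a = a * x * a.

End Ideals.

Lemma indexed_dependent_choice (T : Type) (P : T -> Prop)
    (S : nat -> T -> T -> Prop) (x0 : T) : P x0 ->
  (forall n x, P x -> exists y, P y /\ S n x y) ->
  exists f : nat -> T, (forall n, P (f n)) /\ (forall n, S n (f n) (f n.+1)).
Proof.
move=> Px0 step.
have /choice[next nextP] (p : nat * T) :
    exists y, P p.2 -> P y /\ S p.1 p.2 y.
  have [/(step p.1)[y]|nP] := pselect (P p.2); first by exists y.
  by exists x0.
pose f := fix f n := if n is n'.+1 then next (n', f n') else x0.
have fP n : P (f n) by elim: n => //= n IH; exact: (nextP (n, f n) IH).1.
by exists f; split=> // n; exact: (nextP (n, f n) (fP n)).2.
Qed.

(** * Maximal left ideals and simple modules *)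

(** The last property says that [x] generates a simple submodule of R/N, namely
    R/K for the maximal left ideal [K] of all [l] with [l x] in [N]. *)
Lemma maximal_avoiding (R : pzRingType) (Q : set R^o) (x : R) :
  submodule Q -> ~ Q x ->
  exists N : set R^o, [/\ submodule N, Q `<=` N, ~ N x
    & forall l, ~ N (l * x) -> exists r, N (x - r * (l * x))].
Proof.
move=> hQ Qx.
pose P (N : set R^o) := submodule N /\ ~ N x.
have [//|F FQ FP Ftot|N [QN [hN Nx] maxN]] :=
  @Zorn_above _ P Q.
  split; last by move=> [X FX]; exact: (FP X FX).2.
  by apply: (submodule_bigcup FQ) => // X /FP[].
exists N; split=> // l Nlx; apply: contrapT => no_r.
have /submoduleP[N0 ND] := hN.
pose N' : set R^o := [set z | exists r, N (z - r * (l * x))].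
suff N'E : N' = N.
  by apply: Nlx; rewrite -N'E; exists 1; rewrite mul1r subrr.
apply: maxN; first by move=> z Nz; exists 0; rewrite mul0r subr0.
split; last by move=> [r Nr]; apply: no_r; exists r.
apply/submoduleP; split; first by exists 0; rewrite mul0r subr0.
move=> a u v [r Nu] [s Nv]; exists (a * r + s).
have := ND a _ _ Nu Nv; congr (N _).
by rewrite scalerBr addrACA -opprD mulrDl -mulrA.
Qed.

Lemma quotient_simple (R : pzRingType) (K : set R^o) (hK : submodule K) :
  ~ K 1 -> (forall l, ~ K l -> exists r, K (1 - r * l)) ->
  simple_module (quotient_module hK).
Proof.
move=> K1 maxK; have /submoduleP[K0 KD] := hK.
split.
  exists (to_quotient hK (1 : R)); apply/eqP.
  rewrite -(linear0 (to_quotient hK)) => /to_quotient_eq.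
  by rewrite subr0.
move=> S /submoduleP[S0 SD].
have [SK|] := pselect (forall l, S (to_quotient hK l) -> K l).
  left; apply/seteqP; split=> [q|_ ->//].
  have [l -> /SK Kl] := to_quotient_surj q.
  rewrite /= -(linear0 (to_quotient hK)); apply/to_quotient_eq.
  by rewrite subr0.
move=> /existsNP[l /not_implyP[Sl /maxK[r Kr]]]; right.
apply/seteqP; split=> // q _; have [z ->] := to_quotient_surj q.
have S1 : S (to_quotient hK (1 : R)).
  have /to_quotient_eq -> : K (1 - r * l) by [].
  by have := SD r _ _ Sl S0; rewrite addr0 -linearZ.
by have := SD z _ _ S1 S0; rewrite addr0 -linearZ [z *: _]mulr1.
Qed.

(** * Idempotents in left Sigma-V rings *)

(** Take [N] maximal above [Q] avoiding [x], and [K] the annihilator of [x] in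
    R/N, so that R/K is simple and isomorphic to (Rx + N)/N. The map Rx + N ->
    R/K extends to [h] on [R]; if [h 1] is the class of [t], then [h (t x)] is
    that class too, so [h] kills 1 - tx. The exchange idempotent [e] of tx then
    has [h e = h 1 <> 0], whereas [h] kills [Q]. *)
Lemma Sigma_V_idempotents_avoid (R : pzRingType) (Q : set R) :
  left_Sigma_V_ring R -> exchange_elementwise R -> submodule (Q : set R^o) ->
  idempotents_avoid Q.
Proof.
move=> hV hE hQ x Qx.
have [N [hN QN Nx maxN]] := maximal_avoiding hQ Qx.
have /submoduleP[N0 ND] := hN.
pose K : set R^o := [set r | N (r * x)].
have hK : submodule K.
  apply/submoduleP; rewrite /K; split=> /=; first by rewrite mul0r.
  by move=> a u v Nu Nv; rewrite mulrDl -mulrA; exact: ND.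
have KN1 : ~ K 1 by rewrite /K /= mul1r.
have simpleK : simple_module (quotient_module hK).
  apply: quotient_simple => // l /maxN[r Nr]; exists r.
  by rewrite /K /= mulrBl mul1r -mulrA.
pose G : set (R^o * quotient_module hK) :=
  [set z | exists2 r : R, z.2 = to_quotient hK r & N (z.1 - r * x)].
have [||h hG] := Sigma_injective_extends (hV _ simpleK) (G := G).
- apply/submoduleP; split.
    by exists 0; rewrite ?mul0r ?subr0// linear0.
  move=> a [u u'] [v v'] [r /= -> Nr] [s /= -> Ns].
  exists (a * r + s); first exact: (esym (linearP (to_quotient hK) a r s)).
  have := ND a _ _ Nr Ns; congr (N _).
  by rewrite /= scalerBr addrACA -opprD mulrDl -mulrA.
- move=> _ [r /= -> Nr]; rewrite -(linear0 (to_quotient hK)).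
  apply/to_quotient_eq; rewrite subr0 /K /=.
  by have := ND (-1) _ _ Nr N0; rewrite sub0r addr0 scaleN1r opprK.
have hx : h (x : R) = to_quotient hK (1 : R).
  by apply: hG; exists 1; rewrite ?mul1r ?subrr.
have h1x : h (x : R) <> 0.
  rewrite hx -(linear0 (to_quotient hK)) => /to_quotient_eq.
  by rewrite subr0.
have hN0 z : N z -> h z = 0.
  by move=> Nz; apply: hG; exists 0; rewrite ?mul0r ?subr0 ?linear0.
have [t h1] := to_quotient_surj (h (1 : R)).
have htx : h (t * x) = h (1 : R).
  by rewrite h1; apply: hG; exists t; rewrite ?subrr.
have [e [ee [r eE] [s e1E]]] := hE (t * x).
exists (r * t); rewrite -mulrA -eE; split=> // /QN/hN0 he0.
have he1 : h (1 - e : R) = 0.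
  by rewrite e1E (linearZZ h s) linearB htx subrr scaler0.
apply: h1x; rewrite -[x]mulr1 (linearZZ h x).
move: he1; rewrite linearB => /subr0_eq ->.
by rewrite he0 scaler0.
Qed.

(** Otherwise choose nonzero s_n in e_n M. The partial map r |-> (r s_i)_i,
    defined where the right side has finite support, sends e_n to s_n at index
    n; for an extension [h] of it, [h 1] would be nonzero at every index. *)
Lemma Sigma_injective_orthogonal (R : pzRingType) (M : lmodType R) (e : nat -> R) :
  Sigma_injective M -> orthogonal_idempotents e ->
  exists n, forall m : M, e n *: m = 0.
Proof.
move=> injM orth_e; apply: contrapT => none.
have /choice[t tP] n : exists m : M, e n *: m <> 0.
  by apply/existsNP => all0; apply: none; exists n.
pose s n := e n *: t n.
have es n i : e n *: s i = if i == n then s n else 0.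
  by rewrite /s scalerA orth_e eq_sym; case: eqP => [->//|_]; rewrite scale0r.
pose G := [set z : R^o * direct_power nat M | forall i, z.2 i = (z.1 : R) *: s i].
have [||h hG] := injective_extends (injM nat) (G := G).
- apply/submoduleP; split=> [i|a u v Gu Gv i]; first by rewrite /= scale0r.
  by rewrite /= scalerDl -scalerA -Gu -Gv.
- by move=> m Gm; apply/val_inj/funext => i; rewrite [LHS](Gm i) scale0r.
have hs n : e n *: h (1 : R) n = s n.
  have fin : (fun i => if i == n then s n else 0) \in finite_support (M := M).
    apply/finite_supportP; apply: (@sub_finite_set _ _ [set n]) => // i /=.
    by case: (eqVneq i n) => // _; rewrite eqxx.
  have /(congr1 (fun v : direct_power nat M => v n)) :
      h (e n : R) = DirectPower fin.
    by apply: hG => i /=; rewrite es.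
  rewrite /= eqxx => <-.
  by rewrite -[in RHS](mulr1 (e n)) (linearZZ h (e n)).
apply: infinite_nat.
have /finite_supportP := valP (h (1 : R)); congr finite_set.
apply/seteqP; split=> // n _ /=; apply/eqP => h0.
by apply: (tP n); rewrite -/(s n) -hs h0 scaler0.
Qed.

(** If the e_n all avoid [Q], idempotents g_0 >= g_1 >= ... outside [Q] with
    g_(n+1) in R e_n R are built one after the other. The left ideal generated
    by all 1 - g_n is proper, so it is contained in a maximal left ideal [N],
    and in R/N the class of 1 is fixed by every g_n. Hence no e_n kills R/N. *)
Lemma Sigma_V_prime_no_orthogonal_sequence (R : pzRingType) (Q : set R) :
  left_Sigma_V_ring R -> exchange_elementwise R -> prime_ideal Q ->
  no_orthogonal_sequence Q.
Proof.
move=> hV hE [idQ Q1 primeQ] e orth_e.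
have [Q0 QB QMl QMr] := (idealP Q).1 idQ.
apply: contrapT => /forallNP Qe.
pose P g := g * g = g /\ ~ Q g.
pose S n g g' := g * g' = g' /\ exists u v, g' = u * e n * v.
have [|n g [gg Qg]|g [gP gS]] := @indexed_dependent_choice R P S 1.
- by rewrite /P mul1r.
- have [r Qegr] : exists r, ~ Q (e n * r * g).
    by apply/existsNP => /primeQ[/Qe|].
  have [y [ff Qf]] := Sigma_V_idempotents_avoid hV hE idQ.1 Qegr.
  set f := y * _ in ff Qf.
  have fg : f * g = f by rewrite /f -!mulrA gg.
  exists (g * f); split; last first.
    split; first by rewrite mulrA gg.
    by exists (g * y), (r * g); rewrite /f !mulrA.
  split; first by rewrite mulrA -(mulrA g f) fg -mulrA ff.
  by move=> Qgf; apply: Qf; rewrite -ff -{1}fg -mulrA; exact: QMl.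
have g_le n k : g n * g (n + k)%N = g (n + k)%N.
  elim: k => [|k IH]; first by rewrite addn0 (gP n).1.
  by rewrite addnS -(gS (n + k)%N).1 mulrA IH.
(* As the g n are decreasing idempotents, [I] is the union of the R(1 - g n). *)
pose I : set R^o := [set r | exists n, r * g n = 0].
have hI : submodule I.
  apply/submoduleP; split; first by exists 0%N; rewrite mul0r.
  move=> a x y [m xg] [n yg]; exists (m + n)%N.
  rewrite mulrDl -mulrA -[in x * _]g_le [x * _]mulrA xg mul0r mulr0 add0r.
  by rewrite [(m + n)%N]addnC -g_le mulrA yg mul0r.
have I1 : ~ I 1.
  by move=> [n]; rewrite mul1r => g0; apply: (gP n).2; rewrite g0.
have [N [hN IN N1 maxN]] := maximal_avoiding hI I1.
have simpleN : simple_module (quotient_module hN).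
  apply: quotient_simple => // l Nl.
  by have [|r Nr] := maxN l; [rewrite mulr1|exists r; rewrite mulr1 in Nr].
have [n en0] := Sigma_injective_orthogonal (hV _ simpleN) orth_e.
have [_ [u [v gE]]] := gS n.
apply: N1; rewrite -[1]subr0; apply/(to_quotient_eq hN).
have /(to_quotient_eq hN) -> : N (1 - g n.+1).
  by apply: IN; exists n.+1; rewrite mulrBl mul1r (gP _).1 subrr.
rewrite linear0 gE -mulrA (linearZZ (to_quotient hN) u) (linearZZ _ (e n)).
by rewrite en0 scaler0.
Qed.

(** Start from the idempotent 0 of [L]. As long as an idempotent [g] of [L]
    leaves out some [l], that is l - lg is not in [Q], an idempotent of
    R(l - lg) outside [Q] can be corrected to one orthogonal to [g] and added
    to it. An endless process would give an infinite orthogonal sequence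
    outside [Q]. *)
Lemma left_ideal_idempotent_mod (R : pzRingType) (Q L : set R) :
  ideal Q -> idempotents_avoid Q -> no_orthogonal_sequence Q ->
  submodule (L : set R^o) ->
  exists2 g, L g & forall l, L l -> Q (l - l * g).
Proof.
move=> /idealP[Q0 QB QMl QMr] avoidQ orthQ /submoduleP[L0 LD].
have LM r x : L x -> L (r * x).
  by move=> Lx; rewrite -[_ * _]addr0; exact: (LD r x 0).
have LA x y : L x -> L y -> L (x + y).
  by move=> Lx Ly; rewrite -[x]mul1r; exact: (LD 1 x y).
have LB x y : L x -> L y -> L (x - y).
  by move=> Lx Ly; rewrite -[- y]mulN1r; apply: LA => //; exact: LM.
apply: contrapT => none.
pose P g := L g /\ g * g = g.
pose S (_ : nat) g g' := [/\ g * g' = g, g' * g = g & ~ Q (g' - g)].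
have [|n g [Lg gg]|g [gP gS]] := @indexed_dependent_choice R P S 0.
- by rewrite /P mul0r.
- have [l [Ll Qlg]] : exists l, L l /\ ~ Q (l - l * g).
    apply: contrapT => no_l; apply: none; exists g => // l Ll.
    by apply: contrapT => Ql; apply: no_l; exists l.
  have [y [ff Qf]] := avoidQ _ Qlg.
  have [f fE] : exists f, f = y * (l - l * g) by exists (y * (l - l * g)).
  rewrite /= -fE in ff Qf.
  have fg : f * g = 0 by rewrite fE -mulrA mulrBl -mulrA gg subrr mulr0.
  have Lf : L f by rewrite fE; apply/LM/LB => //; exact: LM.
  have [f' f'E] : exists f', f' = f - g * f by exists (f - g * f).
  have f'g : f' * g = 0 by rewrite f'E mulrBl -mulrA fg mulr0 subr0.
  have gf' : g * f' = 0 by rewrite f'E mulrBr mulrA gg subrr.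
  have f'f : f' * f = f' by rewrite f'E mulrBl -mulrA ff.
  have ff' : f * f' = f by rewrite f'E mulrBr mulrA fg mul0r subr0 ff.
  have f'f' : f' * f' = f' by rewrite -{1}f'f -mulrA ff'.
  exists (g + f'); split.
    split; first by apply: LA => //; rewrite f'E; apply: LB => //; exact: LM.
    by rewrite mulrDl !mulrDr gg gf' f'g f'f' addr0 add0r.
  split; rewrite ?mulrDl ?mulrDr ?gg ?gf' ?f'g ?addr0//.
  rewrite addrAC subrr add0r => Qf'; apply: Qf; rewrite -ff'; exact: QMl.
have g_le i k : g i * g (i + k)%N = g i /\ g (i + k)%N * g i = g i.
  elim: k => [|k [IHl IHr]]; first by rewrite addn0 (gP i).2.
  have [l r _] := gS (i + k)%N; rewrite addnS; split.
    by rewrite -{1}IHl -mulrA l.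
  by rewrite -{1}IHr mulrA r.
have gg i j : g i * g j = g (minn i j).
  case: (leqP i j) => ij; first by rewrite -(subnKC ij) (g_le _ _).1.
  by rewrite -(subnKC (ltnW ij)) (g_le _ _).2.
have [|n] := orthQ (fun n => g n.+1 - g n).
  move=> i j; rewrite mulrBl !mulrBr !gg.
  case: (ltngtP i j) => [ij|ji|->].
  - rewrite (minn_idPl (_ : i.+1 <= j.+1)%N) ?ltnS ?(ltnW ij)//.
    rewrite (minn_idPl ij) (minn_idPl (leqW (ltnW ij))).
    by rewrite !subrr.
  - rewrite (minn_idPr (_ : j.+1 <= i.+1)%N) ?ltnS ?(ltnW ji)//.
    rewrite (minn_idPr ji) (minn_idPr (leqW (ltnW ji))).
    by rewrite subrr.
  by rewrite !minnn (minn_idPr (leqnSn j)) (minn_idPl (leqnSn j)) subrr subr0.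
by have [_ _] := gS n.
Qed.

Lemma regular_mod_ideal (R : pzRingType) (Q : set R) (a : R) :
  ideal Q -> idempotents_avoid Q -> no_orthogonal_sequence Q ->
  exists x, Q (a - a * x * a).
Proof.
move=> idQ avoidQ orthQ.
have [|_ [x _ <-] Qa] :=
    left_ideal_idempotent_mod (L := [set x * a | x in setT]) idQ avoidQ orthQ.
  apply/submoduleP; split; first by exists 0 => //; rewrite mul0r.
  move=> r _ _ [x _ <-] [y _ <-]; exists (r * x + y) => //.
  by rewrite mulrDl -mulrA.
by exists x; rewrite -mulrA; apply: Qa; exists 1; rewrite ?mul1r.
Qed.

(** Let [Q] be maximal among the ideals modulo which [a] is not regular. If [Q]
    were not prime, it would contain the square of the intersection of two
    larger ideals [A] and [B], hence the intersection itself, since ideals are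
    semiprime; but if a - aua is in [A] and a - ava is in [B], then
    (1 - au)(a - ava) is in both, and it has the form a - aza. *)
Lemma Sigma_V_regular (R : pzRingType) :
  left_Sigma_V_ring R -> exchange_elementwise R -> von_neumann_regular R.
Proof.
move=> hV hE a; apply: contrapT => /forallNP a_nreg.
pose P Q := ideal Q /\ forall x, ~ Q (a - a * x * a).
have PM Q r : P Q -> forall x, Q x -> Q (r * x) /\ Q (x * r).
  by move=> [/idealP[_ _ QMl QMr] _] x Qx; split; [exact: QMl|exact: QMr].
have P0 : P [set 0].
  split; last by move=> x /subr0_eq ax; apply: (a_nreg x).
  apply/idealP; split=> [//|x y -> ->|r x ->|r x ->] /=;
  by rewrite ?subrr ?mulr0 ?mul0r.
have [F F0 FP Ftot|Q [_ [idQ aQ] maxQ]] := Zorn_above P0.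
  split; last by move=> x [X /FP[_ aX]]; exact: aX.
  apply/idealP; split=> [|x y|r x|r x].
  - by exists [set 0].
  - move=> [X FX Xx] [Y FY Yy].
    have [XY|YX] := Ftot X Y FX FY.
      have [/idealP[_ YB _ _] _] := FP Y FY.
      by exists Y => //; apply: YB => //; exact: XY.
    have [/idealP[_ XB _ _] _] := FP X FX.
    by exists X => //; apply: XB => //; exact: YX.
  - by move=> [X FX Xx]; exists X => //; exact: (PM X r (FP X FX) x Xx).1.
  - by move=> [X FX Xx]; exists X => //; exact: (PM X r (FP X FX) x Xx).2.
have [Q0 QB QMl QMr] := (idealP Q).1 idQ.
have avoidQ := Sigma_V_idempotents_avoid hV hE idQ.1.
suff primeQ : prime_ideal Q.
  have [x] := regular_mod_ideal a idQ avoidQ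
    (Sigma_V_prime_no_orthogonal_sequence hV hE primeQ).
  exact: aQ.
have semiprimeQ x : (forall r, Q (x * r * x)) -> Q x.
  move=> Qxx; apply: contrapT => /avoidQ[y [ee Qe]]; apply: Qe.
  by rewrite -ee -mulrA; apply: QMl; rewrite mulrA.
have bigger I x : ideal I -> Q `<=` I -> I x -> ~ Q x ->
    exists y, I (a - a * y * a).
  move=> idI QI Ix Qx; apply: contrapT => /forallNP aI.
  by apply: Qx; rewrite -(maxQ I QI).
split=> // [Q1|x y Qxy].
  by apply: (aQ 0); rewrite -[X in Q X]mulr1; exact: QMl.
have [Qx|Qx] := pselect (Q x); [by left|right; apply: contrapT => Qy].
(* Annihilators modulo [Q]: [A] is that of [y], so it contains [x], and [B] is
   that of [A], so it contains [y]. *)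
pose A : set R := [set z | forall r, Q (z * r * y)].
pose B : set R := [set w | forall z r, A z -> Q (z * r * w)].
have idA : ideal A.
  apply/idealP; split=> [r|u v Au Av r|s u Au r|s u Au r] /=.
  - by rewrite !mul0r.
  - by rewrite !mulrBl; exact: QB.
  - by rewrite -!mulrA; apply: QMl; rewrite mulrA.
  - by rewrite -(mulrA u).
have idB : ideal B.
  apply/idealP; split=> [z r _|u v Bu Bv z r Az|s u Bu z r Az|s u Bu z r Az] /=.
  - by rewrite mulr0.
  - by rewrite mulrBr; apply: QB; [exact: Bu|exact: Bv].
  - by rewrite mulrA -(mulrA z); exact: Bu.
  - by rewrite mulrA; apply: QMr; exact: Bu.
have QA' : Q `<=` A by move=> z Qz r; apply/QMr/QMr.
have QB' : Q `<=` B by move=> w Qw z r _; exact: QMl.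
have [u Au] := bigger A x idA QA' Qxy Qx.
have [v Bv] := bigger B y idB QB' (fun z r Az => Az r) Qy.
have [_ _ _ AMr] := (idealP A).1 idA; have [_ _ BMl _] := (idealP B).1 idB.
apply: (aQ (u + v - u * a * v)).
have -> : a - a * (u + v - u * a * v) * a = (1 - a * u) * (a - a * v * a).
  rewrite mulrBr mulrDr mulrBl mulrDl mulrBl mul1r mulrBr !mulrA.
  by rewrite !opprD !opprK !addrA [a - _ - a * v * a]addrAC.
set w := (X in Q X).
have Bw : B w by exact: BMl.
have Aw : A w.
  have -> : w = (a - a * u * a) * (1 - v * a).
    have -> : w = (1 - a * u) * (a * (1 - v * a)).
      by rewrite [a * (1 - _)]mulrBr mulr1 [a * (v * a)]mulrA.
    by rewrite mulrA [(1 - _) * a]mulrBl mul1r.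
  exact: AMr.
by apply: semiprimeQ => r; exact: Bw.
Qed.

(** * The characterization and its symmetry *)

(** The annihilator [Q] of a simple module is prime. Let [G] be a partial linear
    map from [R] with domain [L] to a direct power of the module, which [Q] also
    kills. Choose [g] in [L] generating [L] modulo [Q]. By regularity each
    z = x - xg is zuz with zu in [Q], so [G] sends it to 0; thus [G] sends [x] to x
    times the image of [g]. *)
Lemma regular_Sigma_V (R : pzRingType) :
  von_neumann_regular R ->
  (forall Q : set R, prime_ideal Q -> no_orthogonal_sequence Q) ->
  left_Sigma_V_ring R.
Proof.
move=> regR orthR T [[t0 t0_neq0] simpleT] I.
pose Q : set R := [set r | forall t : T, r *: t = 0].
have idQ : ideal Q.
  apply/idealP; split=> [t|x y Qx Qy t|r x Qx t|r x Qx t].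
  - by rewrite scale0r.
  - by rewrite scalerBl Qx Qy subrr.
  - by rewrite -scalerA Qx scaler0.
  - by rewrite -scalerA Qx.
have primeQ : prime_ideal Q.
  split=> // [Q1|x y Qxy].
    by move: t0_neq0; rewrite -[t0]scale1r Q1 eqxx.
  have [Qy|/existsNP[t yt]] := pselect (Q y); [by right|left=> s].
  have [||yT] := simpleT [set s | exists r, s = r *: (y *: t)].
  - apply/submoduleP; split; first by exists 0; rewrite scale0r.
    by move=> a _ _ [r ->] [q ->]; exists (a * r + q); rewrite scalerDl scalerA.
  - move=> yT0; exfalso; apply: yt.
    have : [set 0] (1 *: (y *: t)) by rewrite -yT0; exists 1.
    by rewrite scale1r.
  have [r ->] : [set s | exists r, s = r *: (y *: t)] s by rewrite yT.
  by rewrite !scalerA Qxy.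
have avoidQ : idempotents_avoid Q.
  move=> x Qx; have [y xE] := regR x; exists y => /=.
  split; first by rewrite -mulrA [x * _]mulrA -xE.
  move=> Qyx; apply: Qx => t; rewrite xE -mulrA -scalerA Qyx.
  exact: scaler0.
apply: Baer_criterion => G hG svG; have /submoduleP[G0 GD] := hG.
have GZ (r x : R) m : G (x, m) -> G (r * x, r *: m).
  by move=> Gx; have := GD r _ _ Gx G0; rewrite addr0.
pose L : set R := [set x | exists m, G (x, m)].
have [|g [m Ggm] gQ] :=
    left_ideal_idempotent_mod (L := L) idQ avoidQ (orthR Q primeQ).
  apply/submoduleP; split; first by exists 0.
  by move=> a x y [m Gx] [n Gy]; exists (a *: m + n); exact: (GD a _ _ Gx Gy).
exists m => x y Gxy; apply/subr0_eq.
have Gz : G (x - x * g, y - (x : R) *: m).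
  have := GD (-1) _ _ (GZ x _ _ Ggm) Gxy.
  by rewrite scaleN1r [- _ + _]addrC.
have {gQ} Qz : Q (x - x * g) by apply: gQ; exists y.
have [z zE] := regR (x - x * g).
have := GZ ((x - x * g) * z) _ _ Gz; rewrite -zE => Gz0.
have kill (v : direct_power I T) : ((x - x * g) * z : R) *: v = 0.
  apply/val_inj/funext => i /=.
  by have [_ _ _ QMr] := (idealP Q).1 idQ; exact: QMr.
rewrite kill in Gz0.
apply: svG; have := GD (-1) _ _ Gz0 Gz.
by rewrite -[-1 *: _ + _]/(_ + _, _ + _) /= !scaleN1r addNr oppr0 add0r.
Qed.

Lemma left_Sigma_V_characterization (R : pzRingType) : exchange_elementwise R ->
  left_Sigma_V_ring R <-> von_neumann_regular R /\
    forall Q : set R, prime_ideal Q -> no_orthogonal_sequence Q.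
Proof.
move=> hE; split=> [hV|[regR orthR]]; last exact: regular_Sigma_V.
split; first exact: Sigma_V_regular.
by move=> Q; exact: Sigma_V_prime_no_orthogonal_sequence.
Qed.

Lemma prime_ideal_converse (R : pzRingType) (Q : set R) :
  @prime_ideal R^c Q <-> prime_ideal Q.
Proof.
split=> -[/idealP[Q0 QB QMl QMr] Q1 primeQ]; split=> //; try exact/idealP.
- by move=> x y Qxy; apply/or_comm/primeQ => r; rewrite [_ * _]mulrA; exact: Qxy.
- move=> x y Qxy; apply/or_comm/primeQ => r.
  by rewrite -[X in Q X]mulrA; exact: Qxy.
Qed.

Lemma orthogonal_idempotents_converse (R : pzRingType) (e : nat -> R) :
  @orthogonal_idempotents R^c e <-> orthogonal_idempotents e.
Proof.
by split=> orth_e i j; rewrite eq_sym; have := orth_e j i; case: eqP => // ->.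
Qed.

Theorem corollary3p6 (R : pzRingType) (hR : exchange_ring R) :
  right_Sigma_V_ring R <-> left_Sigma_V_ring R.
Proof.
have comax (a : R^c) : exists x y : R^c, [/\ a * x + (1 - a) * y = 1,
    y * (a * x) = 0 & x * ((1 - a) * y) = 0].
  by apply: exchange_comaximal hR _; rewrite addrC subrK.
(* The product of [R^c] is reversed, so its right-handed idempotents are the
   left-handed ones of [R]. *)
have exR : exchange_elementwise R.
  move=> a; have [x [y [axby yax xby]]] := comax a.
  exact: (@comaximal_right_idempotent R^c a (1 - a) x y).
have exRc : exchange_elementwise R^c.
  move=> a; have [x [y [axby yax xby]]] := comax a.
  apply: (@comaximal_left_idempotent R^c a (1 - a) x y) => //.
  by rewrite addrC subrK.
apply: (iff_trans (left_Sigma_V_characterization exRc)).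
apply: iff_trans (iff_sym (left_Sigma_V_characterization exR)).
split=> -[regR orthR]; split=> [a|Q primeQ e orth_e].
- by have [x xE] := regR a; exists x; rewrite {1}xE [LHS]mulrA.
- exact: (orthR Q ((@prime_ideal_converse R Q).2 primeQ) e
    ((@orthogonal_idempotents_converse R e).2 orth_e)).
- by have [x xE] := regR a; exists x; rewrite {1}xE [RHS]mulrA.
- exact: (orthR Q ((@prime_ideal_converse R Q).1 primeQ) e
    ((@orthogonal_idempotents_converse R e).1 orth_e)).
Qed.
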